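(* Let $X$ be a pointed metric space and $E$ a Banach space over $\mathbb{K}$. The associated Lipschitz norm $\pi'$ of $\pi$ on $X\boxtimes E$ is $\varepsilon$ on $X^\#\circledast E^*$; that is, for every $\sum_{j=1}^m g_j\boxtimes\phi_j\in X^\#\circledast E^*$, $$\pi'\left(\sum_{j=1}^m g_j\boxtimes\phi_j\right)=\varepsilon\left(\sum_{j=1}^m g_j\boxtimes\phi_j\right):=\sup\left\{\left|\sum_{j=1}^m\gamma(g_j)\langle\phi_j,e\rangle\right|\colon\gamma\in B_{\mathcal{F}(X)},\ e\in B_E\right\}.$$
   Context: $\mathbb{K}$ is $\mathbb{R}$ or $\mathbb{C}$. A pointed metric space $X$ is a metric space (with metric $d$) with a distinguished base point $0$. For a pointed metric space $X$ and a Banach space $F$, $\mathrm{Lip}_0(X,F)$ is the Banach space of all Lipschitz maps $f\colon X\to F$ with $f(0)=0$, normed by the least Lipschitz constant $\mathrm{Lip}(f)$; $X^\#=\mathrm{Lip}_0(X,\mathbb{K})$. $B_Z$ denotes the closed unit ball of a normed space $Z$. $E^*$ is the topological dual of $E$ and $\langle\phi,e\rangle=\phi(e)$; $V'$ denotes the algebraic dual of a vector space $V$. For $x,y\in X$ and $e\in E$, $\delta_{(x,y)}\boxtimes e\in \mathrm{Lip}_0(X,E^* )'$ is the linear functional $f\mapsto\langle f(x)-f(y),e\rangle$. The Lipschitz tensor product $X\boxtimes E$ is the linear subspace of $\mathrm{Lip}_0(X,E^* )'$ spanned by all the functionals $\delta_{(x,y)}\boxtimes e$ with $x,y\in X$,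 $e\in E$. Every $u\in X\boxtimes E$ can be written (non-uniquely) as $u=\sum_{i=1}^n\delta_{(x_i,y_i)}\boxtimes e_i$. The Lipschitz projective norm on $X\boxtimes E$ is $\pi(u)=\inf\left\{\sum_{i=1}^n d(x_i,y_i)\|e_i\|\colon u=\sum_{i=1}^n\delta_{(x_i,y_i)}\boxtimes e_i\right\}$, the infimum being over all representations of $u$. For $g\in X^\#$ and $\phi\in E^*$, $g\boxtimes\phi\in(X\boxtimes E)'$ is the (well-defined) linear functional $(g\boxtimes\phi)\left(\sum_{i=1}^n \delta_{(x_i,y_i)}\boxtimes e_i\right)=\sum_{i=1}^n(g(x_i)-g(y_i))\langle\phi,e_i\rangle$. The space $X^\#\circledast E^*$ is the linear subspace of $(X\boxtimes E)'$ spanned by $\{g\boxtimes\phi\colon g\in X^\#,\ \phi\in E^*\}$. The associated Lipschitz norm $\pi'$ on $X^\#\circledast E^*$ is the restriction of the dual norm of $(X\boxtimes E,\pi)^*$: $\pi'(u^* )=\sup\{|u^*(u)|\colon u\in X\boxtimes E,\ \pi(u)\leq 1\}$. The Lipschitz-free space $\mathcal{F}(X)$ is the closed linear subspace of $(X^\#)^*$ spanned by $\{\delta_x\colon x\in X\}$, where $\delta_x(g)=g(x)$ for $g\in X^\#$. *)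

(* Defs.v *)
From HB Require Import structures.
From mathcomp Require Import all_boot all_order all_algebra.
From mathcomp Require Import all_classical all_reals all_analysis.
From mathcomp Require Import complex.

Set Implicit Arguments.
Unset Strict Implicit.
Unset Printing Implicit Defensive.

Import Order.TTheory GRing.Theory Num.Theory.
Import numFieldNormedType.Exports.

Local Open Scope classical_set_scope.
Local Open Scope ring_scope.

(**md
  Correspondence with the usual notation, [K] standing for [scalars R k]:
  - [rnorm v]           : the norm of [v], as an element of [R];
  - [alg_dual V]        : V', [top_dual E] : E^*;
  - [pmetricType R]     : pointed metric spaces, with base point [point];
  - [lip0 X F]          : Lip_0(X, F), [lip_dual k X] : X^# = Lip_0(X, K);
  - [free_space k X]    : F(X), inside (X^#)^*;
  - [elem_functional x y e], [elem_tensor x y e] : delta_(x,y) [x] e, in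
    Lip_0(X, E^* )' and in the subspace X [x] E = [lip_tensor X E];
  - [box_functional g phi], [box g phi] : g [x] phi, in (X [x] E)' and in the
    subspace X^# (x) E^* = [assoc_tensor X E];
  - [pi_norm], [assoc_norm] : pi and its associated norm pi'.
*)

Variant scalar_kind := RealScalars | ComplexScalars.

Definition scalars (R : realType) (k : scalar_kind) : numFieldType :=
  match k with RealScalars => R | ComplexScalars => R[i] end.

(* The norms of MathComp-Analysis take their values in the scalar field.
   [scal_re] reads such a (nonnegative, hence real) value back in [R]. *)
Definition scal_re (R : realType) (k : scalar_kind) : scalars R k -> R :=
  match k return scalars R k -> R with
  | RealScalars => id
  | ComplexScalars => @complex.Re R
  end.

Definition scal_in (R : realType) (k : scalar_kind) : R -> scalars R k :=
  match k return R -> scalars R k with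
  | RealScalars => id
  | ComplexScalars => fun x => Complex x 0
  end.

Definition rnorm (R : realType) (k : scalar_kind)
    (V : normedZmodType (scalars R k)) (v : V) : R := scal_re `|v|.

Section scalars_lemmas.
Context {R : realType} {k : scalar_kind}.
Implicit Types (x y : R) (a b : scalars R k).

Lemma scal_inK : cancel (@scal_in R k) (@scal_re R k).
Proof. by case: k. Qed.

Lemma scal_reD a b : scal_re (a + b) = scal_re a + scal_re b.
Proof. by move: a b; case: k => //= -[a a'] [b b']. Qed.

Lemma scal_reK a : 0 <= a -> scal_in k (scal_re a) = a.
Proof.
by move: a; case: k => //= -[a b]; rewrite lecE /= => /andP[/eqP -> _].
Qed.

Lemma ler_scal_in x y : (scal_in k x <= scal_in k y) = (x <= y).
Proof. by case: k => //=; rewrite lecE /= eqxx. Qed.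

Lemma scal_in0 : scal_in k 0 = 0 :> scalars R k. Proof. by case: k. Qed.

Lemma scal_in1 : scal_in k 1 = 1 :> scalars R k. Proof. by case: k. Qed.

Lemma scal_inD x y : scal_in k (x + y) = scal_in k x + scal_in k y.
Proof.
by case: k => //=; apply/eqP; rewrite eq_complex /= addr0 !eqxx.
Qed.

Lemma scal_inM x y : scal_in k (x * y) = scal_in k x * scal_in k y.
Proof.
case: k => //=; apply/eqP.
by rewrite eq_complex /= !mulr0 !mul0r subr0 addr0 !eqxx.
Qed.

Lemma scal_in_ge0 x : (0 <= scal_in k x) = (0 <= x).
Proof. by rewrite -[in LHS]scal_in0 ler_scal_in. Qed.

Lemma ler_scal_re a b : 0 <= a -> 0 <= b -> (scal_re a <= scal_re b) = (a <= b).
Proof.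
by move=> a0 b0; rewrite -[in RHS](scal_reK a0) -[in RHS](scal_reK b0) ler_scal_in.
Qed.

Lemma scal_re_ge0 a : 0 <= a -> 0 <= scal_re a.
Proof. by move=> a0; rewrite -scal_in_ge0 scal_reK. Qed.

Lemma scal_reM a b : 0 <= a -> 0 <= b ->
  scal_re (a * b) = scal_re a * scal_re b.
Proof.
by move=> a0 b0; rewrite -[RHS]scal_inK scal_inM !scal_reK.
Qed.

End scalars_lemmas.

Section rnorm_lemmas.
Context {R : realType} {k : scalar_kind} {V : normedZmodType (scalars R k)}.
Implicit Types (v w : V).

Lemma rnormE v : scal_in k (rnorm v) = `|v|.
Proof. exact: scal_reK. Qed.

Lemma rnorm_ge0 v : 0 <= rnorm v. Proof. exact: scal_re_ge0. Qed.

Lemma rnorm0 : rnorm (0 : V) = 0.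
Proof. by rewrite /rnorm normr0 -(scal_in0 (k := k)) scal_inK. Qed.

Lemma rnorm0_eq0 v : rnorm v = 0 -> v = 0.
Proof. by move=> v0; apply: normr0_eq0; rewrite -rnormE v0 scal_in0. Qed.

Lemma ler_rnormD v w : rnorm (v + w) <= rnorm v + rnorm w.
Proof.
by rewrite /rnorm -scal_reD ler_scal_re ?addr_ge0 ?ler_normD.
Qed.

Lemma rnorm_le1 v : (`|v| <= 1) = (rnorm v <= 1).
Proof. by rewrite -rnormE -scal_in1 ler_scal_in. Qed.

Lemma rnormB v w : rnorm (v - w) = rnorm (w - v).
Proof. by rewrite /rnorm distrC. Qed.

End rnorm_lemmas.

Lemma rnormM (R : realType) (k : scalar_kind) (a b : scalars R k) :
  rnorm (a * b) = rnorm a * rnorm b.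
Proof. by rewrite /rnorm normrM scal_reM. Qed.

Lemma rnorm1 (R : realType) (k : scalar_kind) : rnorm (1 : scalars R k) = 1.
Proof. by rewrite /rnorm normr1 -(scal_in1 (k := k)) scal_inK. Qed.

Lemma rnormV (R : realType) (k : scalar_kind) (a : scalars R k) :
  rnorm a^-1 = (rnorm a)^-1.
Proof.
have [->|a0] := eqVneq a 0; first by rewrite invr0 rnorm0 invr0.
have ra0 : rnorm a != 0 by apply: contra_neq a0; exact: rnorm0_eq0.
by apply: (mulfI ra0); rewrite -rnormM !mulfV// rnorm1.
Qed.

Lemma rnormZ (R : realType) (k : scalar_kind)
    (V : normedModType (scalars R k)) (a : scalars R k) (v : V) :
  rnorm (a *: v) = rnorm a * rnorm v.
Proof. by rewrite /rnorm normrZ scal_reM. Qed.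

Definition unit_ball (K : numFieldType) (V : normedModType K) : set V :=
  [set v | `|v| <= 1].
Arguments unit_ball {K} V.


Section span.
Context {K : pzRingType} {V : lmodType K}.
Implicit Type A : set V.

Definition span_pred A : {pred V} :=
  mem [set v | exists (n : nat) (c : 'I_n -> K) (a : 'I_n -> V),
    (forall i, A (a i)) /\ v = \sum_i c i *: a i].

Lemma span_submod_closed A : submod_closed (span_pred A).
Proof.
split.
  by rewrite inE; exists 0%N, (fun=> 0), (fun=> 0); split=> [[]|] //;
    rewrite big_ord0.
move=> b u v; rewrite !inE => -[n [c [a [Aa ->]]]] [m [d [a' [Aa' ->]]]].
exists (n + m)%N.
exists (fun i => match fintype.split i with inl i => b * c i | inr j => d j end).
exists (fun i => match fintype.split i with inl i => a i | inr j => a' j end).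
split=> [i|]; first by case: fintype.split.
rewrite big_split_ord /= scaler_sumr; congr (_ + _).
  by apply: eq_bigr => i _; rewrite -/(fintype.unsplit (inl i)) fintype.unsplitK scalerA.
by apply: eq_bigr => i _; rewrite -/(fintype.unsplit (inr i)) fintype.unsplitK.
Qed.

HB.instance Definition _ A :=
  GRing.isSubmodClosed.Build K V (span_pred A) (span_submod_closed A).

Lemma span_gen A (v : V) : A v -> v \in span_pred A.
Proof.
move=> Av; rewrite inE; exists 1%N, (fun=> 1), (fun=> v).
by split=> //; rewrite big_ord1 scale1r.
Qed.

Record span A : Type := Span { span_val : V ; span_valP : span_val \in span_pred A }.

HB.instance Definition _ A := [isSub for @span_val A].
HB.instance Definition _ A := [Choice of span A by <:].
HB.instance Definition _ A := [SubChoice_isSubLmodule of span A by <:].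

Lemma span_valD A (u v : span A) : span_val (u + v) = span_val u + span_val v.
Proof. by []. Qed.

Lemma span_valZ A (a : K) (u : span A) : span_val (a *: u) = a *: span_val u.
Proof. by []. Qed.

Lemma span_val0 A : span_val (0 : span A) = 0. Proof. by []. Qed.

End span.
Arguments span {K V} A.
Arguments Span {K V} [A] _ _.

Section alg_dual.
Context {K : numFieldType} (V : lmodType K).

Definition alg_dual_pred : {pred V -> K^o} := mem [set f : V -> K^o | scalar f].

Lemma alg_dual_submod_closed : submod_closed alg_dual_pred.
Proof.
split; rewrite ?inE /=.
  by move=> a u v; rewrite -[LHS]/0 -[RHS]/(a * 0 + 0) mulr0 addr0.
move=> a f g; rewrite !inE /= => lf lg b u v.
rewrite !fctE /= lf lg /GRing.scale /= !mulrDr addrACA; congr (_ + _).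
by rewrite !mulrA [b * a]mulrC.
Qed.

HB.instance Definition _ :=
  GRing.isSubmodClosed.Build K (V -> K^o) alg_dual_pred alg_dual_submod_closed.

Record alg_dual : Type :=
  AlgDual { alg_dual_fun : V -> K^o ; alg_dual_funP : alg_dual_fun \in alg_dual_pred }.

HB.instance Definition _ := [isSub for alg_dual_fun].
HB.instance Definition _ := [Choice of alg_dual by <:].
HB.instance Definition _ := [SubChoice_isSubLmodule of alg_dual by <:].
Local Coercion alg_dual_fun : alg_dual >-> Funclass.

Implicit Types (f g : alg_dual) (v : V) (a : K).

Lemma alg_dual_scalar f : scalar f.
Proof. by have := alg_dual_funP f; rewrite inE. Qed.

HB.instance Definition _ (f : alg_dual) :=
  GRing.isLinear.Build K V K *%R (alg_dual_fun f) (@alg_dual_scalar f).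

Lemma alg_dualP f g : f =1 g -> f = g.
Proof. by move=> fg; apply: val_inj; apply: funext. Qed.

Lemma alg_dualDE f g v : (f + g) v = f v + g v. Proof. by []. Qed.

Lemma alg_dualZE a f v : (a *: f) v = a * f v. Proof. by []. Qed.

Lemma alg_dual0E v : (0 : alg_dual) v = 0. Proof. by []. Qed.

End alg_dual.
Arguments alg_dual_pred {K} V _.
Coercion alg_dual_fun : alg_dual >-> Funclass.

Section top_dual.
Context {R : realType} {k : scalar_kind} (E : normedModType (scalars R k)).
Local Notation K := (scalars R k).

Definition top_dual_pred : {pred E -> K^o} :=
  mem [set f : E -> K^o | scalar f /\ continuous f].

Lemma top_dual_submod_closed : submod_closed top_dual_pred.
Proof.
split; rewrite ?inE /=.
  split; last by move=> x; exact: cvg_cst.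
  by move=> a u v; rewrite -[LHS]/0 -[RHS]/(a * 0 + 0) mulr0 addr0.
move=> a f g; rewrite !inE /= => -[lf cf] [lg cg]; split.
  move=> b u v; rewrite !fctE /= lf lg /GRing.scale /= !mulrDr addrACA.
  by congr (_ + _); rewrite !mulrA [b * a]mulrC.
by move=> x; apply: cvgD; [apply: cvgZr; exact: cf | exact: cg].
Qed.

HB.instance Definition _ :=
  GRing.isSubmodClosed.Build K (E -> K^o) top_dual_pred top_dual_submod_closed.

Record top_dual : Type :=
  TopDual { top_dual_fun : E -> K^o ; top_dual_funP : top_dual_fun \in top_dual_pred }.

HB.instance Definition _ := [isSub for top_dual_fun].
HB.instance Definition _ := [Choice of top_dual by <:].
HB.instance Definition _ := [SubChoice_isSubLmodule of top_dual by <:].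
Local Coercion top_dual_fun : top_dual >-> Funclass.

Definition op_norm (f : top_dual) : R := sup [set rnorm (f e) | e in unit_ball E].

Implicit Types (f g : top_dual) (e : E) (a : K).

Lemma top_dual_linear f : scalar f.
Proof. by have := top_dual_funP f; rewrite inE => -[]. Qed.

Lemma top_dual_continuous f : continuous (f : E -> K^o).
Proof. by have := top_dual_funP f; rewrite inE => -[]. Qed.

HB.instance Definition _ (f : top_dual) :=
  GRing.isLinear.Build K E K *%R (top_dual_fun f) (@top_dual_linear f).

Lemma top_dualP f g : f =1 g -> f = g.
Proof. by move=> fg; apply: val_inj; apply: funext. Qed.

Lemma top_dualDE f g e : (f + g) e = f e + g e. Proof. by []. Qed.

Lemma top_dualBE f g e : (f - g) e = f e - g e. Proof. by []. Qed.

Lemma top_dualZE a f e : (a *: f) e = a * f e. Proof. by []. Qed.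

Lemma top_dual_bounded f :
  exists2 C, 0 <= C & forall e, rnorm (f e) <= C * rnorm e.
Proof.
have lf : linear (f : E -> K^o) by exact: top_dual_linear.
pose fL : {linear E -> K^o} :=
  HB.pack (f : E -> K^o) (GRing.isLinear.Build K E K^o *:%R f lf).
have /linear_bounded_continuous/linear_boundedP fb : continuous fL.
  exact: top_dual_continuous.
have [M [Mreal HM]] := fb.
have M0 : 0 <= `|M| + 1 :> K by rewrite addr_ge0.
exists (scal_re (`|M| + 1)); first exact: scal_re_ge0.
move=> e; rewrite /rnorm -scal_reM// ler_scal_re ?mulr_ge0//.
by apply: HM; rewrite (le_lt_trans (real_ler_norm Mreal))// ltrDl.
Qed.

Lemma op_norm_has_sup f : has_sup [set rnorm (f e) | e in unit_ball E].
Proof.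
split; first by exists (rnorm (f 0)), 0 => //; rewrite /unit_ball/= normr0 ler01.
have [C C0 fC] := top_dual_bounded f.
exists C => _ [e /= e1 <-]; rewrite (le_trans (fC e))// -[leRHS]mulr1.
by rewrite ler_wpM2l// -rnorm_le1.
Qed.

Lemma op_norm_le f C :
  (forall e, `|e| <= 1 -> rnorm (f e) <= C) -> op_norm f <= C.
Proof.
move=> fC; apply: ge_sup; first by have [] := op_norm_has_sup f.
by move=> _ [e /= e1 <-]; exact: fC.
Qed.

Lemma ler_op_norm1 f e : `|e| <= 1 -> rnorm (f e) <= op_norm f.
Proof.
move=> e1; apply: ub_le_sup; first by have [] := op_norm_has_sup f.
by exists e.
Qed.

Lemma op_norm_ge0 f : 0 <= op_norm f.
Proof.
by rewrite (le_trans _ (@ler_op_norm1 f 0 _)) ?rnorm_ge0// normr0 ler01.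
Qed.

Lemma ler_op_norm f e : rnorm (f e) <= op_norm f * rnorm e.
Proof.
have [->|e0] := eqVneq e 0; first by rewrite linear0 !rnorm0 mulr0.
have ne0 : `|e| != 0 by rewrite normr_eq0.
have -> : f e = `|e| * f (`|e|^-1 *: e).
  by rewrite linearZ /= mulrA divff// mul1r.
rewrite rnormM mulrC {2}/rnorm normr_id ler_wpM2r ?rnorm_ge0//.
apply: ler_op_norm1; rewrite normrZ normfV normr_id mulVf//.
Qed.

Lemma op_normZ_le a f : op_norm (a *: f) <= rnorm a * op_norm f.
Proof.
apply: op_norm_le => e e1; rewrite top_dualZE rnormM.
by rewrite ler_wpM2l ?rnorm_ge0// ler_op_norm1.
Qed.

Let norm (f : top_dual) : K := scal_in k (op_norm f).

Let normD f g : norm (f + g) <= norm f + norm g.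
Proof.
rewrite -scal_inD ler_scal_in; apply: op_norm_le => e e1.
by rewrite top_dualDE (le_trans (ler_rnormD _ _))// lerD// ler_op_norm1.
Qed.

Let normZ a f : norm (a *: f) = `|a| * norm f.
Proof.
rewrite -rnormE -scal_inM; congr scal_in; apply/eqP.
rewrite eq_le op_normZ_le/=; have [->|a0] := eqVneq a 0.
  by rewrite rnorm0 mul0r op_norm_ge0.
have ra0 : 0 < rnorm a.
  by rewrite lt_neqAle rnorm_ge0 andbT eq_sym; apply: contra_neq a0 => /rnorm0_eq0.
rewrite -ler_pdivlMl// (le_trans _ (le_trans (op_normZ_le a^-1 (a *: f)) _))//.
  by rewrite scalerA mulVf// scale1r.
by rewrite rnormV.
Qed.

Let norm0_eq0 f : norm f = 0 -> f = 0.
Proof.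
rewrite /norm -scal_in0 => /(can_inj (@scal_inK R k)) f0.
apply: top_dualP => e; apply: rnorm0_eq0; apply/le_anti.
by rewrite rnorm_ge0 andbT (le_trans (ler_op_norm f e))// f0 mul0r.
Qed.

HB.instance Definition _ :=
  Lmodule_isNormed.Build K top_dual normD normZ norm0_eq0.

Lemma rnorm_top_dualE f : rnorm f = op_norm f.
Proof. exact: scal_inK. Qed.

End top_dual.
Arguments top_dual_pred {R k} E _.
Coercion top_dual_fun : top_dual >-> Funclass.

#[short(type="pmetricType")]
HB.structure Definition PointedMetric (R : numDomainType) :=
  { X of Metric R X & isPointed X }.

Section lip0.
Context {R : realType} {k : scalar_kind}.
Context (X : pmetricType R) (F : normedModType (scalars R k)).
Local Notation K := (scalars R k).

Definition lip_bound (f : X -> F) (C : R) :=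
  0 <= C /\ forall x y, rnorm (f x - f y) <= C * mdist x y.

Definition lip0_pred : {pred X -> F} :=
  mem [set f : X -> F | f point = 0 /\ exists C, lip_bound f C].

Lemma lip_boundDZ a (f g : X -> F) C D : lip_bound f C -> lip_bound g D ->
  lip_bound (a *: f + g) (rnorm a * C + D).
Proof.
move=> [C0 fC] [D0 gD]; split=> [|x y].
  by rewrite addr_ge0// mulr_ge0// rnorm_ge0.
rewrite !fctE /= opprD addrACA -scalerBr (le_trans (ler_rnormD _ _))//.
by rewrite mulrDl lerD// rnormZ -mulrA ler_wpM2l ?rnorm_ge0.
Qed.

Lemma lip0_submod_closed : submod_closed lip0_pred.
Proof.
split; rewrite ?inE /=.
  split=> //; exists 0; split=> // x y.
  by rewrite mul0r [_ - _]subrr rnorm0.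
move=> a f g; rewrite !inE /= => -[f0 [C fC]] [g0 [D gD]]; split.
  by rewrite !fctE /= f0 g0 scaler0 addr0.
by exists (rnorm a * C + D); exact: lip_boundDZ.
Qed.

HB.instance Definition _ :=
  GRing.isSubmodClosed.Build K (X -> F) lip0_pred lip0_submod_closed.

Record lip0 : Type :=
  Lip0 { lip0_fun : X -> F ; lip0_funP : lip0_fun \in lip0_pred }.

HB.instance Definition _ := [isSub for lip0_fun].
HB.instance Definition _ := [Choice of lip0 by <:].
HB.instance Definition _ := [SubChoice_isSubLmodule of lip0 by <:].
Local Coercion lip0_fun : lip0 >-> Funclass.

Definition lip_const (f : lip0) : R := inf [set C | lip_bound f C].

Implicit Types (f g : lip0) (x y : X) (a : K).

Lemma lip0_point f : f point = 0.
Proof. by have := lip0_funP f; rewrite inE => -[]. Qed.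

Lemma lip0_has_inf f : has_inf [set C | lip_bound f C].
Proof.
split; last by exists 0 => C [].
by have := lip0_funP f; rewrite inE => -[_ [C fC]]; exists C.
Qed.

Lemma lip0P f g : f =1 g -> f = g.
Proof. by move=> fg; apply: val_inj; apply: funext. Qed.

Lemma lip0DE f g x : (f + g) x = f x + g x. Proof. by []. Qed.

Lemma lip0ZE a f x : (a *: f) x = a *: f x. Proof. by []. Qed.

Lemma lip_const_ge0 f : 0 <= lip_const f.
Proof.
by apply: lb_le_inf; [have [] := lip0_has_inf f | move=> C []].
Qed.

Lemma lip_const_le f C : lip_bound f C -> lip_const f <= C.
Proof. by move=> fC; apply: ge_inf => //; have [] := lip0_has_inf f. Qed.

Lemma ler_lip_const f x y : rnorm (f x - f y) <= lip_const f * mdist x y.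
Proof.
have [->|xy] := eqVneq x y; first by rewrite subrr rnorm0 mdistxx mulr0.
rewrite -ler_pdivrMr ?mdist_gt0//; apply: lb_le_inf.
  by have [] := lip0_has_inf f.
by move=> C [_ fC]; rewrite ler_pdivrMr ?mdist_gt0.
Qed.

Lemma lip_boundP f : lip_bound f (lip_const f).
Proof. by split; [exact: lip_const_ge0 | exact: ler_lip_const]. Qed.

Lemma lip_constZ_le a f : lip_const (a *: f) <= rnorm a * lip_const f.
Proof.
rewrite -[a *: f]addr0 -[leRHS]addr0; apply: lip_const_le.
apply: (@lip_boundDZ a f 0 _ 0); first exact: lip_boundP.
by split=> // x y; rewrite mul0r [_ - _]subrr rnorm0.
Qed.

Let norm (f : lip0) : K := scal_in k (lip_const f).

Let normD f g : norm (f + g) <= norm f + norm g.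
Proof.
rewrite -scal_inD ler_scal_in; apply: lip_const_le; split=> [|x y].
  by rewrite addr_ge0// lip_const_ge0.
rewrite !lip0DE opprD addrACA (le_trans (ler_rnormD _ _))//.
by rewrite mulrDl lerD// ler_lip_const.
Qed.

Let normZ a f : norm (a *: f) = `|a| * norm f.
Proof.
rewrite -rnormE -scal_inM; congr scal_in; apply/eqP.
rewrite eq_le lip_constZ_le/=; have [->|a0] := eqVneq a 0.
  by rewrite rnorm0 mul0r lip_const_ge0.
have ra0 : 0 < rnorm a.
  by rewrite lt_neqAle rnorm_ge0 andbT eq_sym; apply: contra_neq a0 => /rnorm0_eq0.
rewrite -ler_pdivlMl// (le_trans _ (le_trans (lip_constZ_le a^-1 (a *: f)) _))//.
  by rewrite scalerA mulVf// scale1r.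
by rewrite rnormV.
Qed.

Let norm0_eq0 f : norm f = 0 -> f = 0.
Proof.
rewrite /norm -scal_in0 => /(can_inj (@scal_inK R k)) f0.
apply: lip0P => x; apply: rnorm0_eq0; apply/le_anti.
rewrite rnorm_ge0 andbT -[f x]subr0 -(lip0_point f).
by rewrite (le_trans (ler_lip_const _ _ _))// f0 mul0r.
Qed.

HB.instance Definition _ := Lmodule_isNormed.Build K lip0 normD normZ norm0_eq0.

Lemma rnorm_lip0E f : rnorm f = lip_const f.
Proof. exact: scal_inK. Qed.

End lip0.
Arguments lip0_pred {R k} X F _.
Coercion lip0_fun : lip0 >-> Funclass.

Section lipschitz_free.
Context {R : realType} (k : scalar_kind) (X : pmetricType R).
Local Notation K := (scalars R k).

Definition lip_dual : Type := lip0 X K^o.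
HB.instance Definition _ := NormedModule.on lip_dual.

Definition eval_fun (x : X) (g : lip_dual) : K^o := (g : lip0 X K^o) x.

Lemma eval_fun_dual x : eval_fun x \in top_dual_pred lip_dual.
Proof.
rewrite inE /=.
have lf : linear (eval_fun x) by [].
split=> //.
pose fL : {linear lip_dual -> K^o} :=
  HB.pack (eval_fun x) (GRing.isLinear.Build K lip_dual K^o *:%R _ lf).
suff : continuous fL by [].
apply/linear_bounded_continuous/linear_boundedP.
near=> M => g.
rewrite (_ : fL g = g x - g point); last by rewrite lip0_point subr0.
rewrite -!rnormE (@le_trans _ _ (scal_in k (mdist x point * rnorm g)))//.
  by rewrite ler_scal_in mulrC rnorm_lip0E ler_lip_const.
rewrite scal_inM ler_wpM2r ?scal_in_ge0 ?rnorm_ge0//.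
near: M; apply: nbhs_pinfty_ge.
by apply: ger0_real; rewrite scal_in_ge0 mdist_ge0.
Unshelve. all: by end_near. Qed.

Definition delta (x : X) : top_dual lip_dual := TopDual (eval_fun_dual x).

Definition free_space : set (top_dual lip_dual) :=
  closure [set` span_pred (range delta)].

End lipschitz_free.
Arguments delta {R} k {X} x.
Arguments free_space {R} k X _.

Section lip_tensor.
Context {R : realType} {k : scalar_kind}.
Context (X : pmetricType R) (E : normedModType (scalars R k)).
Local Notation K := (scalars R k).

Definition diff_eval (x y : X) (e : E) (f : lip0 X (top_dual E)) : K^o :=
  (f x - f y) e.

Lemma diff_eval_dual x y e : diff_eval x y e \in alg_dual_pred _.
Proof.
rewrite inE /= => a f g.
rewrite /diff_eval !top_dualBE !lip0DE !lip0ZE !top_dualDE !top_dualZE.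
by rewrite mulrBr opprD addrACA.
Qed.

Definition elem_functional (x y : X) (e : E) : alg_dual (lip0 X (top_dual E)) :=
  AlgDual (diff_eval_dual x y e).

Definition elem_functionals : set (alg_dual (lip0 X (top_dual E))) :=
  [set u | exists x y e, u = elem_functional x y e].

Definition lip_tensor : Type := span elem_functionals.
HB.instance Definition _ := GRing.Lmodule.on lip_tensor.

Lemma elem_functional_gen x y e :
  elem_functional x y e \in span_pred elem_functionals.
Proof. by apply: span_gen; exists x, y, e. Qed.

Definition elem_tensor (x y : X) (e : E) : lip_tensor :=
  Span _ (elem_functional_gen x y e).

Definition represents (s : seq (X * X * E)) (u : lip_tensor) :=
  u = \sum_(t <- s) elem_tensor t.1.1 t.1.2 t.2.

Lemma elem_functionalZ a x y e :
  a *: elem_functional x y e = elem_functional x y (a *: e).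
Proof.
apply: alg_dualP => f.
by rewrite -[RHS]/((f x - f y) (a *: e)) linearZ.
Qed.

Lemma represents_exists u : exists s, represents s u.
Proof.
have := span_valP u; rewrite inE => -[n [c [a [Aa uE]]]].
have /choice[t tE] : forall i, exists t : X * X * E,
    c i *: a i = elem_functional t.1.1 t.1.2 t.2.
  move=> i; have [x [y [e ->]]] := Aa i.
  by exists (x, y, c i *: e); rewrite elem_functionalZ.
exists [seq t i | i <- index_enum 'I_n]; apply: val_inj.
rewrite big_map raddf_sum /= uE; apply: eq_bigr => i _; exact: tE.
Qed.

Lemma span_valDE (u v : lip_tensor) f :
  span_val (u + v) f = span_val u f + span_val v f.
Proof. exact: (alg_dualDE (span_val u) (span_val v) f). Qed.

Lemma span_valZE a (u : lip_tensor) f : span_val (a *: u) f = a * span_val u f.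
Proof. exact: (alg_dualZE a (span_val u) f). Qed.

Lemma span_val0E f : span_val (0 : lip_tensor) f = 0.
Proof. exact: alg_dual0E. Qed.

Definition pi_norm (u : lip_tensor) : R :=
  inf [set \sum_(t <- s) mdist t.1.1 t.1.2 * rnorm t.2 | s in represents^~ u].

Definition box_sum (g : lip_dual k X) (phi : top_dual E) (s : seq (X * X * E)) : K :=
  \sum_(t <- s) (g t.1.1 - g t.1.2) * phi t.2.

Definition box_fun (g : lip_dual k X) (phi : top_dual E) (u : lip_tensor) : K^o :=
  box_sum g phi (sval (cid (represents_exists u))).

(* The value of [box_fun] does not depend on the representation, because it is
   the value of [u] at the Lipschitz map [x |-> g x *: phi]. *)
Lemma rank_one_lip0 (g : lip_dual k X) (phi : top_dual E) :
  (fun x => g x *: phi) \in lip0_pred X (top_dual E).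
Proof.
rewrite inE /=; split; first by rewrite lip0_point scale0r.
exists (lip_const g * rnorm phi); split=> [|x y].
  by rewrite mulr_ge0 ?lip_const_ge0 ?rnorm_ge0.
rewrite -scalerBl rnormZ mulrAC ler_wpM2r ?rnorm_ge0//.
exact: ler_lip_const.
Qed.

Lemma box_sumE g phi s u : represents s u ->
  box_sum g phi s = (span_val u) (Lip0 (rank_one_lip0 g phi)).
Proof.
move=> ->; elim: s => [|t s IH]; first by rewrite /box_sum !big_nil span_val0E.
rewrite /box_sum !big_cons [X in _ + X]IH span_valDE.
congr (_ + _); rewrite -[RHS]/((g t.1.1 *: phi - g t.1.2 *: phi) t.2).
by rewrite top_dualBE !top_dualZE mulrBl.
Qed.

Lemma box_funE g phi s u : represents s u -> box_fun g phi u = box_sum g phi s.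
Proof.
move=> su; rewrite /box_fun (box_sumE _ _ su).
by case: cid => s' su' /=; rewrite (box_sumE _ _ su').
Qed.

Lemma box_fun_dual g phi : box_fun g phi \in alg_dual_pred lip_tensor.
Proof.
rewrite inE /= => a u v; have fE w : box_fun g phi w =
    (span_val w) (Lip0 (rank_one_lip0 g phi)).
  by rewrite /box_fun; case: cid => s sw /=; exact: box_sumE.
by rewrite !fE span_valDE span_valZE.
Qed.

Definition box_functional (g : lip_dual k X) (phi : top_dual E) :
  alg_dual lip_tensor := AlgDual (box_fun_dual g phi).

Definition box_functionals : set (alg_dual lip_tensor) :=
  [set w | exists g phi, w = box_functional g phi].

Definition assoc_tensor : Type := span box_functionals.
HB.instance Definition _ := GRing.Lmodule.on assoc_tensor.

Lemma box_functional_gen g phi :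
  box_functional g phi \in span_pred box_functionals.
Proof. by apply: span_gen; exists g, phi. Qed.

Definition box (g : lip_dual k X) (phi : top_dual E) : assoc_tensor :=
  Span _ (box_functional_gen g phi).

Definition assoc_norm (w : assoc_tensor) : R :=
  sup [set rnorm (span_val w u) | u in [set u | pi_norm u <= 1]].

End lip_tensor.

(* Main.v *)
Require Import Defs.
From mathcomp Require Import all_boot all_order all_algebra.
From mathcomp Require Import all_classical all_reals all_analysis.

Import Order.TTheory GRing.Theory Num.Theory.
Import numFieldNormedType.Exports.
Local Open Scope classical_set_scope.
Local Open Scope ring_scope.

(** For [e] in [E] put [slice e := \sum_j phi j e *: g j], a Lipschitz function
    on [X].  Both sides of the equality are the supremum of the Lipschitz
    constants of the functions [slice e], [e] in the unit ball of [E].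

    The functional [w := \sum_j box (g j) (phi j)] takes the value
    [slice e x - slice e y] at the elementary tensor of [x], [y], [e]
    ([box_sum_elem]), while [\sum_j gamma (g j) * phi j e = gamma (slice e)]
    for every [gamma] in the dual of X^# ([slice_dual]).

    The associated norm is at most the supremum because elementary tensors
    determine it: a bound [C * (mdist x y * rnorm e)] for [w] on them gives
    [C] as a bound for its dual norm ([assoc_norm_le]), since the projective
    norm is an infimum over representations by elementary tensors.  Now
    [slice e x - slice e y] is [mdist x y] times the value at [slice e] of the
    molecule (delta_x - delta_y) / d(x, y), and molecules belong to the
    unit ball of the free space ([molecule_free], [molecule_unit_ball]).

    Conversely, if [gamma] and [e] lie in the unit balls, [gamma (slice e)] is at
    most the Lipschitz constant of [slice e], and each difference quotient of
    [slice e] is the value of [w] at an elementary tensor of projective norm at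
    most 1 ([rnorm_slice_le_assoc_norm]). *)

Lemma rnorm_scal_in (R : realType) (k : scalar_kind) (x : R) :
  0 <= x -> rnorm (scal_in k x) = x.
Proof. by move=> x0; rewrite /rnorm ger0_norm ?scal_in_ge0// scal_inK. Qed.

Lemma ler_rnorm_sum (R : realType) (k : scalar_kind)
    (V : normedZmodType (scalars R k)) (I : Type) (r : seq I) (F : I -> V) :
  rnorm (\sum_(i <- r) F i) <= \sum_(i <- r) rnorm (F i).
Proof.
elim: r => [|i r IH]; first by rewrite !big_nil rnorm0.
by rewrite !big_cons (le_trans (ler_rnormD _ _))// lerD2l.
Qed.

Section projective_norm.
Context {R : realType} {k : scalar_kind}.
Context (X : pmetricType R) (E : normedModType (scalars R k)).
Local Notation tensor := (lip_tensor X E).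

Lemma pi_norm_elem_le (x y : X) (e : E) :
  pi_norm (elem_tensor x y e) <= mdist x y * rnorm e.
Proof.
apply: ge_inf.
  exists 0 => _ [s _ <-]; apply: sumr_ge0 => t _.
  by rewrite mulr_ge0 ?mdist_ge0 ?rnorm_ge0.
exists [:: (x, y, e)]; last by rewrite big_seq1.
by rewrite /represents big_seq1.
Qed.

(** The representations of [u] bound [w u] one by one, by the triangle
    inequality; the infimum of these bounds is [C * pi_norm u]. *)
Lemma ler_pi_norm (w : alg_dual tensor) (C : R) : 0 <= C ->
  (forall x y e, rnorm (w (elem_tensor x y e)) <= C * (mdist x y * rnorm e)) ->
  forall u, rnorm (w u) <= C * pi_norm u.
Proof.
move=> C0 wC u.
have wS s : represents s u ->
    rnorm (w u) <= C * \sum_(t <- s) mdist t.1.1 t.1.2 * rnorm t.2.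
  move=> ->; rewrite linear_sum mulr_sumr.
  rewrite (le_trans (ler_rnorm_sum _ _ _ _ _ _))//.
  by apply: ler_sum => t _; exact: wC.
(* Comparing with the infimum means dividing by [C]; when [C = 0] a single
   representation already shows that [w u] vanishes. *)
have [s0 s0u] := represents_exists u.
move: C0; rewrite le_eqVlt => /predU1P[C0|C0].
  by have := wS _ s0u; rewrite -C0 !mul0r.
rewrite -ler_pdivrMl//; apply: lb_le_inf.
  by exists (\sum_(t <- s0) mdist t.1.1 t.1.2 * rnorm t.2), s0.
by move=> _ [s su <-]; rewrite ler_pdivrMl// wS.
Qed.

Lemma pi_norm0_le (x y : X) : pi_norm (elem_tensor x y (0 : E)) <= 1.
Proof. by rewrite (le_trans (pi_norm_elem_le _ _ _))// rnorm0 mulr0. Qed.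

Lemma assoc_norm_le (w : assoc_tensor X E) (C : R) : 0 <= C ->
  (forall x y e, rnorm (span_val w (elem_tensor x y e)) <=
    C * (mdist x y * rnorm e)) ->
  assoc_norm w <= C.
Proof.
move=> C0 wC; apply: ge_sup.
  exists (rnorm (span_val w (elem_tensor point point 0))).
  by exists (elem_tensor point point 0) => //; exact: pi_norm0_le.
move=> _ [u /= u1 <-]; rewrite (le_trans (ler_pi_norm _ _ C0 wC u))//.
by rewrite -[leRHS]mulr1 ler_wpM2l.
Qed.

(** The bound on elementary tensors makes the set of values bounded; without it
    the supremum defining [assoc_norm w] would be a default value. *)
Lemma ler_assoc_norm (w : assoc_tensor X E) (C : R) : 0 <= C ->
  (forall x y e, rnorm (span_val w (elem_tensor x y e)) <=
    C * (mdist x y * rnorm e)) ->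
  forall u, pi_norm u <= 1 -> rnorm (span_val w u) <= assoc_norm w.
Proof.
move=> C0 wC u u1; apply: ub_le_sup; last by exists u.
exists C => _ [v /= v1 <-]; rewrite (le_trans (ler_pi_norm _ _ C0 wC v))//.
by rewrite -[leRHS]mulr1 ler_wpM2l.
Qed.

End projective_norm.

Section molecules.
Context {R : realType} {k : scalar_kind} {X : pmetricType R}.

(** Since [0^-1 = 0], the molecule is zero when [x = y], so it is in the unit
    ball of the free space for all [x] and [y]. *)
Definition molecule (x y : X) : top_dual (lip_dual k X) :=
  (scal_in k (mdist x y))^-1 *: (delta k x - delta k y).

Lemma molecule_free x y : free_space k X (molecule x y).
Proof.
apply: subset_closure; rewrite /= rpredZ// rpredB//.
- by apply: span_gen; exists x.
- by apply: span_gen; exists y.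
Qed.

Lemma moleculeE x y (g : lip_dual k X) :
  molecule x y g = (scal_in k (mdist x y))^-1 * (g x - g y).
Proof. by []. Qed.

Lemma molecule_unit_ball x y :
  unit_ball (top_dual (lip_dual k X)) (molecule x y).
Proof.
rewrite /unit_ball /= rnorm_le1 rnorm_top_dualE.
apply: op_norm_le => g; rewrite rnorm_le1 rnorm_lip0E => g1.
rewrite moleculeE rnormM rnormV rnorm_scal_in ?mdist_ge0//.
have [->|xy] := eqVneq x y; first by rewrite mdistxx invr0 mul0r.
rewrite ler_pdivrMl ?mdist_gt0// mulr1 (le_trans (ler_lip_const _ _ _))//.
by rewrite -[leRHS]mul1r ler_wpM2r ?mdist_ge0.
Qed.

Lemma moleculeK x y (g : lip_dual k X) :
  scal_in k (mdist x y) * molecule x y g = g x - g y.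
Proof.
rewrite moleculeE; have [->|xy] := eqVneq x y; first by rewrite subrr !mulr0.
rewrite mulVKf// -(scal_in0 (k := k)) (can_eq (@scal_inK R k)).
by rewrite gt_eqF ?mdist_gt0.
Qed.

End molecules.

Section slices.
Context {R : realType} {k : scalar_kind}.
Context {X : pmetricType R} {E : normedModType (scalars R k)} {m : nat}.
Context (g : 'I_m -> lip_dual k X) (phi : 'I_m -> top_dual E).

(** This is the image of [e] under the finite-rank operator from E to X^#
    that corresponds to the sum of the [box (g j) (phi j)]. *)
Definition slice (e : E) : lip_dual k X := \sum_j phi j e *: g j.

Lemma slice_dual (gamma : top_dual (lip_dual k X)) e :
  gamma (slice e) = \sum_j gamma (g j) * phi j e.
Proof.
rewrite linear_sum; apply: eq_bigr => j _.
by rewrite linearZ/= mulrC.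
Qed.

Lemma sliceZ a e : slice (a *: e) = a *: slice e.
Proof.
rewrite scaler_sumr; apply: eq_bigr => j _.
by rewrite linearZ/= scalerA.
Qed.

Lemma slice0 : slice 0 = 0.
Proof. by rewrite -[X in slice X](scale0r 0) sliceZ scale0r. Qed.

Lemma box_sum_elem x y e :
  span_val (\sum_j box (g j) (phi j)) (elem_tensor x y e) = slice e x - slice e y.
Proof.
have -> : slice e x - slice e y = \sum_j (g j x - g j y) * phi j e.
  rewrite -[LHS]/((delta k x - delta k y) (slice e)) slice_dual.
  by apply: eq_bigr.
have evalE (I : Type) (r : seq I) (F : I -> assoc_tensor X E) u :
    span_val (\sum_(i <- r) F i) u = \sum_(i <- r) span_val (F i) u.
  elim: r => [|i r IH]; first by rewrite !big_nil.
  by rewrite !big_cons -IH.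
rewrite evalE; apply: eq_bigr => j _.
rewrite /= (@box_funE _ _ _ _ _ _ [:: (x, y, e)]); last first.
  by rewrite /represents big_seq1.
by rewrite /box_sum big_seq1.
Qed.

Lemma rnorm_slice_le e :
  rnorm (slice e) <= (\sum_j rnorm (g j) * rnorm (phi j)) * rnorm e.
Proof.
rewrite mulr_suml (le_trans (ler_rnorm_sum _ _ _ _ _ _))//.
apply: ler_sum => j _; rewrite rnormZ mulrC -mulrA ler_wpM2l ?rnorm_ge0//.
by rewrite [rnorm (phi j)]rnorm_top_dualE ler_op_norm.
Qed.

Lemma rnorm_slice_dual_le (gamma : top_dual (lip_dual k X)) e : `|gamma| <= 1 ->
  rnorm (gamma (slice e)) <= rnorm (slice e).
Proof.
rewrite rnorm_le1 => gamma1; rewrite (le_trans (ler_op_norm _ _))//.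
by rewrite -rnorm_top_dualE -[leRHS]mul1r ler_wpM2r ?rnorm_ge0.
Qed.

(** The difference quotient of [slice e] at [x], [y] is the value of the sum of
    the [box (g j) (phi j)] at the elementary tensor of [x], [y] and
    [(mdist x y)^-1 *: e], whose projective norm is at most [rnorm e <= 1]. *)
Lemma rnorm_slice_le_assoc_norm e : `|e| <= 1 ->
  rnorm (slice e) <= assoc_norm (\sum_j box (g j) (phi j)).
Proof.
rewrite rnorm_le1 => e1; set w := \sum_j _.
pose C := \sum_j rnorm (g j) * rnorm (phi j).
have C0 : 0 <= C by apply: sumr_ge0 => j _; rewrite mulr_ge0 ?rnorm_ge0.
have wC x y f :
    rnorm (span_val w (elem_tensor x y f)) <= C * (mdist x y * rnorm f).
  rewrite box_sum_elem (le_trans (ler_lip_const _ _ _))// -rnorm_lip0E.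
  by rewrite [leRHS]mulrCA [leRHS]mulrC ler_wpM2r ?mdist_ge0// rnorm_slice_le.
have wle := ler_assoc_norm _ _ _ _ C0 wC.
rewrite rnorm_lip0E; apply: lip_const_le; split=> [|x y].
  apply: le_trans (wle (elem_tensor point point 0) _); first exact: rnorm_ge0.
  exact: pi_norm0_le.
have [->|xy] := eqVneq x y; first by rewrite subrr rnorm0 mdistxx mulr0.
have d0 : 0 < mdist x y by rewrite mdist_gt0.
pose a := (scal_in k (mdist x y))^-1.
have aE : rnorm a = (mdist x y)^-1 by rewrite rnormV rnorm_scal_in// ltW.
have := wle (elem_tensor x y (a *: e)).
rewrite box_sum_elem sliceZ !lip0ZE -scalerBr rnormZ aE ler_pdivrMl// mulrC.
apply; rewrite (le_trans (pi_norm_elem_le _ _ _ _ _))//.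
by rewrite rnormZ aE mulVKf ?gt_eqF.
Qed.

End slices.

Theorem theorem8p6 (R : realType) (k : scalar_kind) (X : pmetricType R)
    (E : completeNormedModType (scalars R k)) (m : nat)
    (g : 'I_m -> lip_dual k X) (phi : 'I_m -> top_dual E) :
  assoc_norm (\sum_j box (g j) (phi j)) =
  sup [set rnorm (\sum_j gamma (g j) * phi j e) |
        gamma in free_space k X `&` unit_ball (top_dual (lip_dual k X)) &
        e in unit_ball E].
Proof.
set w := \sum_j box _ _; set S := [set _ | _ in _ & _ in _].
have Sle r : S r -> r <= assoc_norm w.
  move=> [gamma [_ gamma1] [e e1 <-]]; rewrite -slice_dual.
  rewrite (le_trans (rnorm_slice_dual_le _ _ _ _ gamma1))//.
  exact: rnorm_slice_le_assoc_norm.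
have Ssup x y e : `|e| <= 1 -> rnorm (molecule x y (slice g phi e)) <= sup S.
  move=> e1; apply: ub_le_sup; first by exists (assoc_norm w).
  rewrite slice_dual; exists (molecule x y).
    by split; [exact: molecule_free | exact: molecule_unit_ball].
  by exists e.
have e01 : `|0 : E| <= 1 by rewrite normr0.
apply/le_anti/andP; split; last first.
  apply: ge_sup => //; exists (rnorm (\sum_j molecule point point (g j) * phi j 0)).
  exists (molecule point point); last by exists 0.
  by split; [exact: molecule_free | exact: molecule_unit_ball].
have S0 : 0 <= sup S by apply: le_trans (Ssup point point 0 e01); exact: rnorm_ge0.
apply: assoc_norm_le => // x y e.
rewrite box_sum_elem -moleculeK rnormM rnorm_scal_in ?mdist_ge0//.
rewrite mulrCA ler_wpM2l ?mdist_ge0//.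
have [->|e0] := eqVneq e 0.
  by rewrite slice0 linear0 !rnorm0 mulr0.
have ne0 : `|e| != 0 by rewrite normr_eq0.
rewrite -[e in leLHS](scalerKV ne0) sliceZ linearZ/= rnormM {1}/rnorm normr_id.
rewrite mulrC ler_wpM2r ?rnorm_ge0// Ssup//.
by rewrite normrZ normfV normr_id mulVf.
Qed.
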